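(* Let $d\ge 1$ be an integer. The Gardner polytope $\mathcal{G}_d$ and the Birkhoff polytope $\mathcal{B}_d$ form a Gale-dual pair of polytopes in $\mathbb{R}^{d\times d}$; that is, $$\mathcal{G}_d=\mathbb{R}^{d\times d}_{\ge 0}\cap\{A\in\mathbb{R}^{d\times d}:\langle A,B\rangle=1\text{ for all }B\in V(\mathcal{B}_d)\},$$ $$\mathcal{B}_d=\mathbb{R}^{d\times d}_{\ge 0}\cap\{B\in\mathbb{R}^{d\times d}:\langle A,B\rangle=1\text{ for all }A\in V(\mathcal{G}_d)\}.$$ Explicitly, $$\mathcal{G}_d=\mathbb{R}^{d\times d}_{\ge 0}\cap\{A:\langle A,P_\sigma\rangle=1\text{ for all permutations }\sigma\text{ of }[d]\}=\operatorname{conv}(R_i,C_j: i,j=1,\dots,d),$$ $$\mathcal{B}_d=\operatorname{conv}(P_\sigma:\sigma\text{ a permutation of }[d])=\mathbb{R}^{d\times d}_{\ge 0}\cap\{B:\langle B,R_i\rangle=\langle B,C_j\rangle=1\text{ for } i,j=1,\dots,d\}.$$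
   Context: Let $[d]=\{1,\dots,d\}$. The Gardner polytope $\mathcal{G}_d\subset\mathbb{R}^{d\times d}$ is the set of matrices $A$ with nonnegative real entries such that $A_{1,\sigma(1)}+\cdots+A_{d,\sigma(d)}=1$ for every permutation $\sigma$ of $[d]$. The Birkhoff polytope $\mathcal{B}_d\subset\mathbb{R}^{d\times d}$ is the set of doubly stochastic matrices, i.e. matrices with nonnegative real entries all of whose row sums and column sums equal $1$. For a polytope $\mathcal{P}$, $V(\mathcal{P})$ denotes its set of vertices. $\langle A,B\rangle=\operatorname{tr}(A^tB)=\sum_{i,j}A_{ij}B_{ij}$ is the standard inner product on $\mathbb{R}^{d\times d}$, and $\mathbb{R}^{d\times d}_{\ge 0}$ is the set of matrices with nonnegative entries. For a permutation $\sigma$ of $[d]$, $P_\sigma$ is the $0/1$-matrix with $(P_\sigma)_{ij}=1$ if and only if $\sigma(i)=j$. For $i\in[d]$, $R_i$ (respectively $C_i$) is the $d\times d$ matrix whose entries in the $i$th row (respectively $i$th column) are $1$ and whose remaining entries are $0$. In general, polytopes $\mathcal{P},\mathcal{Q}\subset\mathbb{R}^D$ are a Gale-dual pair if $\mathcal{P}=\mathbb{R}^D_{\ge 0}\cap\{x:\langle x,y\rangle=1\text{ for }y\in V(\mathcal{Q})\}$ and $\mathcal{Q}=\mathbb{R}^D_{\ge 0}\cap\{y:\langle x,y\rangle=1\text{ for }x\in V(\mathcal{P})\}$. *)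

(* Defs.v *)
From HB Require Import structures.
From mathcomp Require Import all_boot all_order all_algebra perm.
From mathcomp Require Import boolp classical_sets cardinality reals convex.

Set Implicit Arguments.
Unset Strict Implicit.
Unset Printing Implicit Defensive.

Import Order.TTheory GRing.Theory Num.Theory.

Local Open Scope classical_set_scope.
Local Open Scope ring_scope.

Definition mxinner (R : realType) (m n : nat) (A B : 'M[R]_(m, n)) : R :=
  \tr (A^T *m B).

Definition nonneg_mx (R : realType) (m n : nat) : set 'M[R]_(m, n) :=
  [set A | forall i j, 0 <= A i j].

Definition convex_hull (R : realType) (m n : nat) (X : set 'M[R]_(m, n)) :
    set 'M[R]_(m, n) :=
  smallest (fun Y : set 'M[R]_(m, n) => convex_set Y) X.

Definition is_polytope (R : realType) (m n : nat) (P : set 'M[R]_(m, n)) :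
    Prop :=
  exists2 X : set 'M[R]_(m, n), finite_set X & P = convex_hull X.

(* The zero-dimensional faces: [set v] is the intersection of P with the
   hyperplane <c, x> = b of an inequality <c, x> <= b valid on P.  As usual for
   faces, c = 0 is allowed, so a one-point polytope has a vertex. *)
Definition vertices (R : realType) (m n : nat) (P : set 'M[R]_(m, n)) :
    set 'M[R]_(m, n) :=
  [set v | exists (c : 'M[R]_(m, n)) (b : R),
     (forall x, P x -> mxinner c x <= b) /\
     P `&` [set x | mxinner c x = b] = [set v]].

Definition gale_dual_pair (R : realType) (m n : nat)
    (P Q : set 'M[R]_(m, n)) : Prop :=
  [/\ is_polytope P,
      is_polytope Q,
      P = @nonneg_mx R m n `&`
            [set x | forall y, vertices Q y -> mxinner x y = 1]
    & Q = @nonneg_mx R m n `&`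
            [set y | forall x, vertices P x -> mxinner x y = 1]].

Definition gardner (R : realType) (d : nat) : set 'M[R]_d :=
  [set A | (forall i j, 0 <= A i j) /\
           forall s : 'S_d, \sum_(i < d) A i (s i) = 1].

Definition birkhoff (R : realType) (d : nat) : set 'M[R]_d :=
  [set A | [/\ forall i j, 0 <= A i j,
               forall i, \sum_(j < d) A i j = 1
             & forall j, \sum_(i < d) A i j = 1]].

Definition row_ones (R : realType) (d : nat) (i : 'I_d) : 'M[R]_d :=
  \matrix_(k, l) (k == i)%:R.

Definition col_ones (R : realType) (d : nat) (j : 'I_d) : 'M[R]_d :=
  \matrix_(k, l) (l == j)%:R.

(* Main.v *)
(* Both explicit hull descriptions carry the proof.  For a Gardner matrix,
   comparing two permutations that differ by a transposition gives
   A i j + A k l = A i l + A k j, so A i j = a i + b j; anchoring at a minimal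
   entry of one column makes all a i and b j nonnegative, and they sum to 1.
   The Birkhoff half is Birkhoff-von Neumann, via Hall's marriage theorem.
   A vertex of a hull is one of its generators, and each generator is a vertex,
   being the only point of its polytope with support inside its own support;
   Gale duality then follows from the inequality descriptions. *)
Require Import Defs.
From HB Require Import structures.
From mathcomp Require Import all_boot all_order all_algebra perm.

Set Implicit Arguments.
Unset Strict Implicit.
Unset Printing Implicit Defensive.

(** * Hall's marriage theorem *)

(** Strong induction on [#|X|], splitting on whether some nonempty proper subset of [X] is tight,
    i.e. has no more neighbours than elements. The point [y0] only supplies values of [f] when [X]
    is empty. *)
Lemma hall_marriage (T T' : finType) (X : {set T}) (N : T -> {set T'})
    (y0 : T') :
  (forall A : {set T}, A \subset X ->
     (#|A| <= #|\bigcup_(x in A) N x|)%N) ->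
  exists f : T -> T', {in X &, injective f} /\ forall x, x \in X -> f x \in N x.
Proof.
have [n] := ubnP #|X|; elim: n X N => // n IHn X N leXn hallN.
have [->|[x xX]] := set_0Vmem X.
  by exists (fun=> y0); split=> [x y|x]; rewrite inE.
have [/existsP[A /and4P[sAX A0 AX leNA]]|/existsPn strict] :=
  boolP [exists A : {set T}, [&& A \subset X, A != set0, A != X
           & (#|\bigcup_(x in A) N x| <= #|A|)%N]].
  have ltAX : (#|A| < #|X|)%N by rewrite proper_card // properEneq AX.
  have [||f1 [f1I f1N]] := IHn A N.
  - exact: leq_trans ltAX _.
  - by move=> B sBA; apply: hallN; apply: subset_trans sAX.
  pose NA := (\bigcup_(x in A) N x).
  have [||f2 [f2I f2N]] := IHn (X :\: A) (fun x => N x :\: NA).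
  - rewrite ltnS in leXn; apply: leq_trans leXn.
    rewrite cardsD (setIidPr sAX) ltn_subrL card_gt0 A0 /=.
    by apply/card_gt0P; exists x.
  - move=> B; rewrite subsetD => /andP[sBX dBA].
    have -> : (\bigcup_(x in B) (N x :\: NA) = (\bigcup_(x in B) N x) :\: NA).
      apply/setP=> y; rewrite !inE; apply/bigcupP/andP.
        case=> z zB; rewrite inE => /andP[? ?]; split=> //.
        by apply/bigcupP; exists z.
      by case=> yNA /bigcupP[z zB yz]; exists z => //; rewrite inE yNA.
    (* Hall's condition for [A :|: B] counts [NA] plus the neighbours of [B] outside [NA]; tightness
       of [A] lets [#|A|] cancel against [#|NA|]. *)
    have := hallN (A :|: B); rewrite subUset sAX sBX => /(_ isT).
    rewrite bigcup_setU cardsU (_ : (A :&: B = set0)); last first.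
      by apply/eqP; rewrite setI_eq0 disjoint_sym.
    rewrite cards0 subn0 -/NA -(cardsID NA (NA :|: _)).
    rewrite setIUl setIid setDUl setDv set0U.
    rewrite (setUidPl _) ?subsetIr // => leAB.
    by rewrite -(leq_add2l #|A|) (leq_trans leAB) // leq_add2r.
  exists (fun z => if z \in A then f1 z else f2 z); split=> [y z yX zX|z zX].
    (* The two partial matchings cannot collide: [f1] takes values in [NA] and [f2] avoids it. *)
    have f12 u v : u \in A -> v \in X -> v \notin A -> f1 u != f2 v.
      move=> uA vX vA; apply: contraTneq (f2N v _); last by rewrite inE vA.
      by move=> <-; rewrite inE negb_and negbK; apply/orP; left;
         apply/bigcupP; exists u => //; apply: f1N.
    case: ifPn => yA; case: ifPn => zA.
    - exact: f1I.
    - by move/eqP; rewrite (negbTE (f12 _ _ _ _ _)).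
    - by move/esym/eqP; rewrite (negbTE (f12 _ _ _ _ _)).
    - by apply: f2I; rewrite inE ?yA ?zA.
  case: ifPn => zA; first exact: f1N.
  by have := f2N z; rewrite inE zA zX => /(_ isT); rewrite inE => /andP[].
(* Without tight subsets, [x] may be matched to any neighbour [y]: every nonempty proper subset has
   a neighbour to spare, so deleting [y] preserves Hall's condition. *)
have /card_gt0P[y yN] : (0 < #|N x|)%N.
  have := hallN [set x]; rewrite sub1set xX => /(_ isT).
  by rewrite cards1 big_set1.
have [||f [fI fN]] := IHn (X :\ x) (fun z => N z :\ y).
- by move: leXn; rewrite (cardsD1 x) xX.
- move=> B; rewrite subsetD1 => /andP[sBX xB].
  have [->|B0] := eqVneq B set0; first by rewrite cards0.
  have -> : (\bigcup_(x in B) (N x :\ y) = (\bigcup_(x in B) N x) :\ y).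
    apply/setP=> u; rewrite !inE; apply/bigcupP/andP.
      case=> z zB; rewrite !inE => /andP[? ?]; split=> //.
      by apply/bigcupP; exists z.
    by case=> uy /bigcupP[z zB yz]; exists z => //; rewrite !inE uy.
  have BX : B != X by apply: contraNneq xB => ->.
  have := strict B; rewrite sBX B0 BX /= -ltnNge (cardsD1 y).
  by case: (_ \in _) => [//|]; apply: ltnW.
exists (fun z => if z == x then y else f z); split=> [u v uX vX|z zX].
  have fy z : z \in X -> z != x -> f z != y.
    by move=> zX zx; have := fN z; rewrite !inE zx zX => /(_ isT) /andP[].
  case: eqVneq => [->|ux]; case: eqVneq => [->|vx] //.
  - by move/esym/eqP; rewrite (negbTE (fy _ _ _)).
  - by move/eqP; rewrite (negbTE (fy _ _ _)).
  - by apply: fI; rewrite !inE ?ux ?vx.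
case: eqVneq => [->//|zx].
by have := fN z; rewrite !inE zx zX => /(_ isT) /andP[].
Qed.

(* Imported only here, since classical_sets shadows the finset lemmas used
   above. *)
From mathcomp Require Import boolp classical_sets cardinality reals convex.
From mathcomp Require Import interval_inference ring.

Import Order.TTheory GRing.Theory Num.Theory.

Local Open Scope classical_set_scope.
Local Open Scope ring_scope.

(** * Finite convex combinations *)

Section Convexity.
Variables (R : realType) (M : lmodType R).
Implicit Type A : set (convex_lmodType M).

Lemma convex_setP A :
  convex_set A <->
  forall (x y : M) (t : R), 0 <= t -> t <= 1 -> A x -> A y ->
    A (t *: x + (1 - t) *: y).
Proof.
split=> [cA x y t t0 t1 Ax Ay|cA x y t].
  by have /set_mem := cA x y (Itv01 t0 t1) (mem_set Ax) (mem_set Ay).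
move=> /set_mem Ax /set_mem Ay; apply/mem_set.
exact: (cA x y t%:num).
Qed.

(** Induction over sublists, whose weights need not sum to 1; hence partial sums are normalised by
    their total weight, assumed positive. *)
Lemma convex_set_sum A (I : finType) (w : I -> R) (v : I -> M) :
  convex_set A -> (forall i, 0 <= w i) -> \sum_i w i = 1 ->
  (forall i, A (v i)) -> A (\sum_i w i *: v i).
Proof.
move=> /convex_setP cA w0 w1 Av.
suff hr (r : seq I) : 0 < \sum_(i <- r) w i ->
    A ((\sum_(i <- r) w i)^-1 *: \sum_(i <- r) w i *: v i).
  by have := hr (index_enum I); rewrite w1 ltr01 invr1 scale1r; apply.
elim: r => [|i r IHr]; first by rewrite big_nil ltxx.
rewrite !big_cons; set W := \sum_(j <- r) w j in IHr *.
have : 0 <= W by apply: sumr_ge0.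
(* A tail of total weight 0 has no barycentre, but then all its weights vanish and only [v i]
   remains. *)
rewrite le_eqVlt => /orP[/eqP W0|Wgt0 _].
  have /allP wr0 : all (fun j => true ==> (w j == 0)) r.
    by rewrite -psumr_eq0 // -/W -W0.
  rewrite [X in _ *: (_ + X)]big_seq_cond big1 => [|j /andP[jr _]]; last first.
    by rewrite (eqP (wr0 _ jr)) scale0r.
  rewrite -W0 !addr0 => wi; rewrite scalerA mulVf ?scale1r ?gt_eqF //.
have wW : 0 < w i + W by rewrite ltr_wpDl.
set V := \sum_(j <- r) w j *: v j in IHr *.
have -> : (w i + W)^-1 *: (w i *: v i + V) =
    (w i / (w i + W)) *: v i + (1 - w i / (w i + W)) *: (W^-1 *: V).
  rewrite scalerDr !scalerA [_^-1 * _]mulrC; congr (_ + _ *: _).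
  by field; rewrite !gt_eqF.
apply: cA => //; last exact: IHr.
- by rewrite divr_ge0 // ltW.
- by rewrite ler_pdivrMr // mul1r lerDl ltW.
Qed.

End Convexity.

Section InnerProduct.
Variables (R : realType) (m n : nat).
Implicit Types A B C : 'M[R]_(m, n).

Lemma mxinnerE A B : mxinner A B = \sum_i \sum_j A i j * B i j.
Proof.
rewrite /mxinner /mxtrace exchange_big /=; apply: eq_bigr => j _.
by rewrite mxE; apply: eq_bigr => i _; rewrite mxE.
Qed.

Lemma mxinnerC A B : mxinner A B = mxinner B A.
Proof.
by rewrite !mxinnerE; do 2!apply: eq_bigr => ? _; rewrite mulrC.
Qed.

Lemma mxinnerDr A B C : mxinner A (B + C) = mxinner A B + mxinner A C.
Proof. by rewrite /mxinner mulmxDr mxtraceD. Qed.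

Lemma mxinnerZr a A B : mxinner A (a *: B) = a * mxinner A B.
Proof. by rewrite /mxinner -scalemxAr mxtraceZ. Qed.

End InnerProduct.

(** * Convex hulls and their vertices *)

Section HullVertices.
Variables (R : realType) (m n : nat).
Implicit Types (P X : set 'M[R]_(m, n)).

Lemma convex_hull_sum X (I : finType) (w : I -> R) (v : I -> 'M[R]_(m, n)) :
  (forall i, 0 <= w i) -> \sum_i w i = 1 -> (forall i, X (v i)) ->
  convex_hull X (\sum_i w i *: v i).
Proof.
by move=> w0 w1 Xv Y [cY sXY]; apply: convex_set_sum => // i; apply: sXY.
Qed.

(* If no point of X attained the maximum of the linear form, then X, hence its
   hull, would lie in an open half-space missing the vertex. *)
Lemma vertices_convex_hull X : vertices (convex_hull X) `<=` X.
Proof.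
move=> v [c [b [cb face]]].
have [hv cv] : convex_hull X v /\ mxinner c v = b.
  by have : [set v] v by []; rewrite -face.
have [[x Xx cx]|nX] := pselect (exists2 x, X x & mxinner c x = b).
  suff -> : v = x by [].
  have : [set v] x by rewrite -face; split => //; apply: sub_gen_smallest.
  by [].
suff : mxinner c v < b by rewrite cv ltxx.
apply: (hv [set x | mxinner c x < b]); split=> [|x Xx] /=.
  apply/convex_setP => x y t t0 t1 /= xb yb.
  rewrite mxinnerDr !mxinnerZr.
  have [->|t_neq0] := eqVneq t 0; first by rewrite mul0r add0r subr0 mul1r.
  have t_gt0 : 0 < t by rewrite lt_neqAle eq_sym t_neq0.
  have -> : b = t * b + (1 - t) * b by ring.
  by rewrite ltr_leD ?ltr_pM2l // ler_wpM2l ?subr_ge0 // ltW.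
rewrite lt_neqAle cb ?andbT; last exact: sub_gen_smallest.
by apply/eqP => cx; apply: nX; exists x.
Qed.

(* The exposing functional is minus the sum of the entries off the support
   of v. *)
Lemma vertex_of_support P (v : 'M[R]_(m, n)) :
  P `<=` @nonneg_mx R m n -> P v ->
  (forall x, P x -> (forall i j, v i j = 0 -> x i j = 0) -> x = v) ->
  vertices P v.
Proof.
move=> P0 Pv Psupp; exists (\matrix_(i, j) - (v i j == 0)%:R), 0.
have le0 x i j : P x -> (\matrix_(i, j) - (v i j == 0)%:R) i j * x i j <= 0.
  by move=> Px; rewrite mxE mulNr oppr_le0 mulr_ge0 ?ler0n //; apply: P0.
split=> [x Px|].
  by rewrite mxinnerE; do 2!apply: sumr_le0 => ? _; apply: le0.
apply/seteqP; split=> [x [Px /= /eqP]|_ ->].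
  (* Nonpositive terms summing to 0 all vanish, first across rows and then within a row, so [x] is
     zero wherever [v] is. *)
  rewrite -oppr_eq0 mxinnerE -sumrN psumr_eq0; last first.
    by move=> i _; rewrite oppr_ge0; apply: sumr_le0 => j _; apply: le0.
  move=> /allP x0; apply: Psupp => // i j vij.
  have := x0 i (mem_index_enum _); rewrite -sumrN psumr_eq0; last first.
    by move=> k _; rewrite oppr_ge0; apply: le0.
  move=> /allP /(_ j (mem_index_enum _)).
  by rewrite /= mxE vij eqxx mulN1r opprK => /eqP.
split=> //=; rewrite mxinnerE; do 2!apply: big1 => ? _; rewrite mxE.
by case: eqP => [->|_]; rewrite ?mulr0 // oppr0 mul0r.
Qed.

End HullVertices.

Lemma exists_argmin (R : realType) (I : finType) (F : I -> R) (i : I) :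
  exists i0, forall j, F i0 <= F j.
Proof.
case: (@Order.TotalTheory.arg_minP _ _ _ i xpredT F) => // i0 _ i0min.
by exists i0 => j; apply: i0min.
Qed.

(** * The Gardner polytope *)

Section Gardner.
Variables (R : realType) (d : nat).
Implicit Types (A : 'M[R]_d) (s : 'S_d) (i j k l : 'I_d).

Lemma mxinner_perm A s : mxinner A (perm_mx s) = \sum_i A i (s i).
Proof.
rewrite mxinnerE; apply: eq_bigr => i _; rewrite (bigD1 (s i)) //=.
rewrite !mxE eqxx mulr1 big1 ?addr0 // => j jsi.
by rewrite !mxE eq_sym (negbTE jsi) mulr0.
Qed.

Lemma mxinner_row_ones A i : mxinner A (row_ones R i) = \sum_j A i j.
Proof.
rewrite mxinnerE (bigD1 i) //= [X in _ + X]big1 ?addr0 => [|k ki].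
  by apply: eq_bigr => j _; rewrite mxE eqxx mulr1.
by apply: big1 => j _; rewrite mxE (negbTE ki) mulr0.
Qed.

Lemma mxinner_col_ones A j : mxinner A (col_ones R j) = \sum_i A i j.
Proof.
rewrite mxinnerE; apply: eq_bigr => i _.
rewrite (bigD1 j) //= !mxE eqxx mulr1 big1 ?addr0 // => k kj.
by rewrite mxE (negbTE kj) mulr0.
Qed.

Lemma gardner_convex : convex_set (@gardner R d).
Proof.
apply/convex_setP => x y t t0 t1 [x0 xs] [y0 ys]; split=> [i j|s].
  by rewrite !mxE addr_ge0 // mulr_ge0 ?subr_ge0.
under eq_bigr do rewrite !mxE.
by rewrite big_split /= -!mulr_sumr xs ys !mulr1 subrKC.
Qed.

Lemma gardner_row_ones i : gardner (row_ones R i).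
Proof.
split=> [k l|s]; first by rewrite mxE ler0n.
rewrite (bigD1 i) //= mxE eqxx big1 ?addr0 // => k ki.
by rewrite mxE (negbTE ki).
Qed.

Lemma gardner_col_ones j : gardner (col_ones R j).
Proof.
split=> [k l|s]; first by rewrite mxE ler0n.
rewrite (bigD1 ((s^-1)%g j)) //= mxE permKV eqxx big1 ?addr0 // => k ki.
by rewrite mxE -(inj_eq (@perm_inj _ (s^-1)%g)) permK (negbTE ki).
Qed.

Lemma gardner_exchange A i j k l :
  gardner A -> A i j + A k l = A i l + A k j.
Proof.
case=> _ As.
have [->|ik] := eqVneq i k; first by rewrite addrC.
have [->//|jl] := eqVneq j l.
(* First [u] sends [i] to [j]; a second transposition moves [u k] to [l] and fixes [j], since
   neither [u k] nor [l] equals [j]. *)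
have [s [si sk]] : exists s : 'S_d, s i = j /\ s k = l.
  pose u := tperm i j; have uk : u k != j.
    by rewrite -(tpermL i j) (inj_eq perm_inj) eq_sym.
  exists (u * tperm (u k) l)%g; rewrite !permM tpermL; split.
    by rewrite tpermD // eq_sym.
  by rewrite tpermL.
(* This permutation exchanges the images of [i] and [k] and agrees with [s] elsewhere, so the
   remaining terms cancel. *)
have := As (tperm i k * s)%g; rewrite -(As s).
rewrite (bigD1 i) // (bigD1 k) 1?eq_sym //=.
rewrite [in RHS](bigD1 i) // [in RHS](bigD1 k) 1?eq_sym //=.
rewrite !permM tpermL tpermR si sk.
rewrite (eq_bigr (fun z => A z (s z))); last first.
  by move=> z /andP[zi zk]; rewrite permM tpermD // eq_sym.
by rewrite !addrA => /addIr.
Qed.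

Lemma gardner_hull : (0 < d)%N ->
  @gardner R d = convex_hull (range (@row_ones R d) `|` range (@col_ones R d)).
Proof.
move=> d0; apply/seteqP; split; last first.
  apply: smallest_sub; first exact: gardner_convex.
  by move=> _ [[i _ <-]|[j _ <-]];
    [exact: gardner_row_ones|exact: gardner_col_ones].
move=> A gA; have [A0 As] := gA; pose j0 : 'I_d := Ordinal d0.
have [i0 i0min] := exists_argmin (fun i => A i j0) j0.
(* Row weights are the excess over the minimum of column [j0], hence nonnegative; column weights are
   the entries of row [i0]. *)
pose w (k : 'I_d + 'I_d) :=
  match k with inl i => A i j0 - A i0 j0 | inr j => A i0 j end.
pose v (k : 'I_d + 'I_d) :=
  match k with inl i => row_ones R i | inr j => col_ones R j end.
have AE : A = \sum_k w k *: v k.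
  apply/matrixP => i j; rewrite big_sumType /= mxE !summxE.
  rewrite (bigD1 i) //= [X in _ + X + _]big1; last first.
    by move=> k ki; rewrite !mxE eq_sym (negbTE ki) mulr0.
  rewrite (bigD1 j) //= [X in _ + (_ + X)]big1; last first.
    by move=> k kj; rewrite !mxE eq_sym (negbTE kj) mulr0.
  rewrite !mxE !eqxx !mulr1 !addr0 addrAC -(gardner_exchange i j i0 j0 gA).
  by rewrite addrK.
rewrite AE; apply: convex_hull_sum.
- by case=> k /=; rewrite ?subr_ge0.
(* By the exchange identity, the row and column weights of index [i] add up to [A i i], so the total
   is the sum for the identity permutation. *)
- rewrite -(As 1%g) big_sumType /= -big_split /=; apply: eq_bigr => i _.
  rewrite perm1 addrAC -(gardner_exchange i i i0 j0 gA).
  by rewrite addrK.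
- by case=> k; [left|right]; exists k.
Qed.

(** If [x] is supported in row [i], a permutation sending [i] to [l] has [x i l] as its only
    surviving term, which forces it to be 1. *)
Lemma vertices_gardner_row_ones i : vertices (@gardner R d) (row_ones R i).
Proof.
apply: vertex_of_support; [by move=> x [] | exact: gardner_row_ones | ].
move=> x [_ xs] supp; apply/matrixP => k l; rewrite mxE.
have [->|ki] := eqVneq k i; last by apply: supp; rewrite mxE (negbTE ki).
have := xs (tperm i l); rewrite (bigD1 i) //= tpermL big1 ?addr0 // => z zi.
by apply: supp; rewrite mxE (negbTE zi).
Qed.

Lemma vertices_gardner_col_ones j : vertices (@gardner R d) (col_ones R j).
Proof.
apply: vertex_of_support; [by move=> x [] | exact: gardner_col_ones | ].
move=> x [_ xs] supp; apply/matrixP => k l; rewrite mxE.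
have [->|lj] := eqVneq l j; last by apply: supp; rewrite mxE (negbTE lj).
have := xs (tperm k j); rewrite (bigD1 k) //= tpermL big1 ?addr0 // => z zk.
apply: supp; rewrite mxE -[in X in _ == X](tpermL k j) (inj_eq perm_inj).
by rewrite (negbTE zk).
Qed.

End Gardner.

(** * The Birkhoff polytope and the Birkhoff-von Neumann theorem *)

Section Birkhoff.
Variables (R : realType) (d : nat).
Implicit Types (A : 'M[R]_d) (s : 'S_d) (i j k l : 'I_d).

Lemma birkhoff_convex : convex_set (@birkhoff R d).
Proof.
apply/convex_setP => x y t t0 t1 [x0 xr xc] [y0 yr yc]; split=> [i j|i|j].
- by rewrite !mxE addr_ge0 // mulr_ge0 ?subr_ge0.
- under eq_bigr do rewrite !mxE.
  by rewrite big_split /= -!mulr_sumr xr yr !mulr1 subrKC.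
- under eq_bigr do rewrite !mxE.
  by rewrite big_split /= -!mulr_sumr xc yc !mulr1 subrKC.
Qed.

Lemma sum_perm_mx_row s i : \sum_j perm_mx s i j = 1 :> R.
Proof.
rewrite (bigD1 (s i)) //= !mxE eqxx big1 ?addr0 // => j jsi.
by rewrite !mxE eq_sym (negbTE jsi).
Qed.

Lemma sum_perm_mx_col s j : \sum_i perm_mx s i j = 1 :> R.
Proof.
rewrite -[RHS](sum_perm_mx_row s^-1%g j); apply: eq_bigr => i _.
by rewrite !mxE -(inj_eq (@perm_inj _ s^-1%g)) permK eq_sym.
Qed.

Lemma perm_mx_ge0 s i j : 0 <= perm_mx s i j :> R.
Proof. by rewrite !mxE ler0n. Qed.

Lemma birkhoff_perm_mx s : birkhoff (perm_mx s : 'M[R]_d).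
Proof.
split; [exact: perm_mx_ge0|exact: sum_perm_mx_row|exact: sum_perm_mx_col].
Qed.

(** Hall's condition by double counting: the rows in [B] carry mass [c * #|B|], all of it in the
    columns [NB], whose total mass is [c * #|NB|]. A general [c] lets the lemma be reused after
    multiples of permutation matrices are subtracted. *)
Lemma line_sums_positive_perm A (c : R) :
  (0 < d)%N -> 0 < c -> (forall i j, 0 <= A i j) ->
  (forall i, \sum_j A i j = c) -> (forall j, \sum_i A i j = c) ->
  exists s : 'S_d, forall i, 0 < A i (s i).
Proof.
move=> d0 c0 A0 Ar Ac.
have [|f [fI fN]] := @hall_marriage _ _ [set: 'I_d]%SET
  (fun i => [set j | 0 < A i j]%SET) (Ordinal d0).
  move=> B _; set NB := (\bigcup_(i in B) _)%SET.
  rewrite -(ler_nat R) -(ler_pM2l c0).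
  have sumc (C : {set 'I_d}) : c * #|C|%:R = \sum_(i in C) c.
    by rewrite sumr_const mulr_natr.
  rewrite !sumc -(eq_bigr _ (fun i _ => Ar i)) -(eq_bigr _ (fun j _ => Ac j)).
  rewrite [leRHS]exchange_big [leRHS](bigID (mem B)) /= ler_wpDr //.
    by do 2!apply: sumr_ge0 => ? _.
  apply: ler_sum => i iB.
  rewrite (bigID (mem NB)) /= [X in _ + X]big1 ?addr0 //.
  move=> j jNB; apply/eqP; move: (A0 i j).
  rewrite le_eqVlt => /orP[/eqP<-//|Aij].
  by case/negP: jNB; apply/bigcupP; exists i; rewrite ?inE.
have fI' : injective f by move=> x y; apply: fI; rewrite inE.
exists (perm fI') => i; rewrite permE.
by have := fN i; rewrite !inE; apply.
Qed.

(* Subtract the largest multiple of a permutation matrix inside the support;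
   this kills an entry and keeps all line sums equal. *)
Lemma line_sums_perm_decomposition A (c : R) :
  (0 < d)%N -> (forall i j, 0 <= A i j) ->
  (forall i, \sum_j A i j = c) -> (forall j, \sum_i A i j = c) ->
  exists2 w : 'S_d -> R, forall s, 0 <= w s & A = \sum_s w s *: perm_mx s.
Proof.
move=> d0; pose supp A := [set p : 'I_d * 'I_d | A p.1 p.2 != 0]%SET.
have [n] := ubnP #|supp A|; elim: n A c => // n IHn A c leAn A0 Ar Ac.
have : 0 <= c by rewrite -(Ar (Ordinal d0)); apply: sumr_ge0.
rewrite le_eqVlt => /orP[/eqP c0|cgt0].
  exists (fun=> 0) => //; rewrite big1 => [|s _]; last by rewrite scale0r.
  apply/matrixP => i j; rewrite mxE; move/eqP: (Ar i).
  by rewrite -c0 psumr_eq0 // => /allP /(_ j (mem_index_enum _)) /eqP.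
have [s spos] := line_sums_positive_perm d0 cgt0 A0 Ar Ac.
have [i0 i0min] := exists_argmin (fun i => A i (s i)) (Ordinal d0).
set m := A i0 (s i0) in i0min; pose A' := A - m *: perm_mx s.
have A'E i j : A' i j = if s i == j then A i j - m else A i j.
  by rewrite !mxE; case: eqP; rewrite ?mulr1 ?mulr0 ?subr0.
have m0 : 0 < m by apply: spos.
have [||||w w0 A'w] := IHn A' (c - m).
- rewrite ltnS in leAn; apply: leq_trans leAn; apply: proper_card.
  apply/properP; split; last first.
    by exists (i0, s i0); rewrite !inE ?A'E /= ?eqxx ?subrr ?eqxx // gt_eqF.
  apply/fintype.subsetP => -[i j]; rewrite !inE A'E /=.
  case: (s i =P j) => [<- _|//].
  by rewrite gt_eqF.
- by move=> i j; rewrite A'E; case: eqP => // <-; rewrite subr_ge0.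
- move=> i; under eq_bigr do rewrite 3!mxE.
  by rewrite big_split sumrN -mulr_sumr sum_perm_mx_row Ar mulr1.
- move=> j; under eq_bigr do rewrite 3!mxE.
  by rewrite big_split sumrN -mulr_sumr sum_perm_mx_col Ac mulr1.
exists (fun t => w t + m * (t == s)%:R) => [t|].
  by rewrite addr_ge0 // mulr_ge0 ?ler0n // ltW.
under eq_bigr do rewrite scalerDl.
rewrite big_split /= -A'w (bigD1 s) //= eqxx mulr1.
rewrite big1 ?addr0 ?subrK // => t ts.
by rewrite (negbTE ts) mulr0 scale0r.
Qed.

Lemma birkhoff_hull : (0 < d)%N ->
  @birkhoff R d = convex_hull (range (fun s : 'S_d => perm_mx s)).
Proof.
move=> d0; apply/seteqP; split; last first.
  apply: smallest_sub; first exact: birkhoff_convex.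
  by move=> _ [s _ <-]; exact: birkhoff_perm_mx.
move=> A [A0 Ar Ac]; have [w w0 Aw] := line_sums_perm_decomposition d0 A0 Ar Ac.
rewrite Aw; apply: convex_hull_sum => [//||s]; last by exists s.
(* The decomposition does not state the total weight; it is read off from one row of [A], as every
   permutation matrix has row sum 1. *)
rewrite -(Ar (Ordinal d0)) Aw; under [RHS]eq_bigr do rewrite summxE.
rewrite exchange_big /=; apply: eq_bigr => s _.
by under eq_bigr do rewrite mxE; rewrite -mulr_sumr sum_perm_mx_row mulr1.
Qed.

(** Within the support of [perm_mx s], each row has a single free entry, and its row sum makes that
    entry 1. *)
Lemma vertices_birkhoff_perm_mx s : vertices (@birkhoff R d) (perm_mx s).
Proof.
apply: vertex_of_support; [by move=> x [] | exact: birkhoff_perm_mx | ].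
move=> x [_ xr _] supp; apply/matrixP => i j; rewrite !mxE.
have x0 k : k != s i -> x i k = 0.
  by move=> ki; apply: supp; rewrite !mxE eq_sym (negbTE ki).
case: eqVneq => [<-|ji]; last by rewrite x0 // eq_sym.
by rewrite -(xr i) (bigD1 (s i)) //= big1 ?addr0.
Qed.

End Birkhoff.

(** * Gale duality *)

Theorem mainTheorem6 (R : realType) (d : nat) (d_ge1 : (1 <= d)%N) :
  gale_dual_pair (@gardner R d) (@birkhoff R d) /\
  [/\ @gardner R d =
        @nonneg_mx R d d `&`
          [set A | forall s : 'S_d, mxinner A (perm_mx s) = 1],
      @gardner R d =
        convex_hull (range (@row_ones R d) `|` range (@col_ones R d)),
      @birkhoff R d = convex_hull (range (fun s : 'S_d => perm_mx s))
    & @birkhoff R d =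
        @nonneg_mx R d d `&`
          [set B | (forall i : 'I_d, mxinner B (row_ones R i) = 1) /\
                   (forall j : 'I_d, mxinner B (col_ones R j) = 1)]].
Proof.
have gE : @gardner R d = @nonneg_mx R d d `&`
    [set A | forall s : 'S_d, mxinner A (perm_mx s) = 1].
  apply/seteqP; split=> A [A0 As]; split=> // s.
    by rewrite mxinner_perm.
  by rewrite -mxinner_perm.
have bE : @birkhoff R d = @nonneg_mx R d d `&`
    [set B | (forall i : 'I_d, mxinner B (row_ones R i) = 1) /\
             (forall j : 'I_d, mxinner B (col_ones R j) = 1)].
  apply/seteqP; split=> [B [B0 Br Bc]|B [B0 [Br Bc]]].
    by do 2!split=> //; move=> ?; rewrite (mxinner_row_ones, mxinner_col_ones).
  by split=> // ?; rewrite -(mxinner_row_ones, mxinner_col_ones).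
have gH := gardner_hull R d_ge1; have bH := birkhoff_hull R d_ge1.
split; split=> //.
- exists (range (@row_ones R d) `|` range (@col_ones R d)) => //.
  by rewrite finite_setU; split; apply: finite_image; exact: finite_finset.
- exists (range (fun s : 'S_d => perm_mx s)) => //.
  by apply: finite_image; exact: finite_finset.
(* The constraints for vertices and for hull generators agree, as each vertex is a generator and
   conversely; the next case does the same with the roles exchanged. *)
- rewrite [LHS]gE; congr (_ `&` _); apply/seteqP; split=> A /= hA.
    by move=> y; rewrite bH => /vertices_convex_hull[s _ <-].
  by move=> s; apply: hA; apply: vertices_birkhoff_perm_mx.
- rewrite [LHS]bE; congr (_ `&` _); apply/seteqP; split=> B /=.
    case=> Br Bc x; rewrite gH => /vertices_convex_hull[] [k _ <-];
      by rewrite mxinnerC.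
  move=> hB; split=> k; rewrite mxinnerC; apply: hB.
    exact: vertices_gardner_row_ones.
  exact: vertices_gardner_col_ones.
Qed.
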